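(* Let $\Omega$ be an open convex set in $\mathbb{H}^n\subset\mathbb{R}^{n,1}$, where the inclusion is the isometric embedding of $\mathbb{H}^n$ as the hyperboloid $\{x: \|x\|_m^2=-1,\ x_{n+1}>0\}$, and let $H$ be the hyperbolic Hilbert metric of $\Omega$. Let $\tilde\Omega$ be the image of $\Omega$ under the projection $P$ from the origin onto the hyperplane $\{x_{n+1}=1\}$, an open convex set in this hyperplane, with its Euclidean Hilbert metric $\tilde H$. Then the projection map $P:(\Omega,H)\to(\tilde\Omega,\tilde H)$ is an isometry.
   Context: $\mathbb{R}^{n,1}$ is $\mathbb{R}^{n+1}$ with the Minkowski norm $\|x\|_m^2=x_1^2+\cdots+x_n^2-x_{n+1}^2$; $\mathbb{H}^n$ is the hyperboloid with its induced hyperbolic distance $d$ (curvature $-1$). The projection from the origin is $P(x)=x/x_{n+1}$. For distinct $x,y\in\Omega$, $R(x,y)$ is the hyperbolic geodesic ray starting at $x$ and passing through $y$; if it meets $\partial\Omega$, $b(x,y)$ is the intersection point. The hyperbolic Funk metric of $\Omega$ is $F(x,y)=\log\dfrac{\sinh d(x,b(x,y))}{\sinh d(y,b(x,y))}$ if $x\neq y$ and $R(x,y)\cap\partial\Omega\neq\emptyset$, and $F(x,y)=0$ otherwise; the hyperbolic Hilbert metric of $\Omega$ is $H(x,y)=\frac12\big(F(x,y)+F(y,x)\big)$, that is, $$H(x,y)=\frac12\log\left[\frac{\sinh d(x,b(x,y))}{\sinh d(y,b(x,y))}\cdot\frac{\sinh d(y,b(y,x))}{\sinh d(x,b(y,x))}\right]$$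 when both boundary points exist. The Euclidean Hilbert metric $\tilde H$ of $\tilde\Omega\subset\{x_{n+1}=1\}\cong\mathbb{R}^n$ is $\tilde H(u,v)=\frac12\big(\tilde F(u,v)+\tilde F(v,u)\big)$, where $\tilde F(u,v)=\log\dfrac{|u-b(u,v)|}{|v-b(u,v)|}$ if $u\neq v$ and the Euclidean ray from $u$ through $v$ meets $\partial\tilde\Omega$, at the point $b(u,v)$, and $\tilde F(u,v)=0$ otherwise. An isometry is a distance-preserving bijection.
   Formalization: As worded the claim fails for Ω=H^n (n≥1): H=0 but H̃ is the Klein metric. The isometry is stated when every ray R(x,y), x≠y in Ω, meets ∂Ω; for general open convex Ω, H̃(Px,Py)=H(x,y) is stated for pairs whose two boundary points both exist. *)

(* Defs.v *)
From HB Require Import structures.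
From mathcomp Require Import all_boot all_order all_algebra.
From mathcomp Require Import all_classical all_reals all_analysis.

Set Implicit Arguments.
Unset Strict Implicit.
Unset Printing Implicit Defensive.

Import Order.TTheory GRing.Theory Num.Theory.
Import numFieldNormedType.Exports.

Local Open Scope classical_set_scope.
Local Open Scope ring_scope.

Section FunkHilbert.
Context {R : realType} {T : choiceType}.
Implicit Types (ray : T -> T -> set T) (bd : set T) (len : T -> T -> R).

(* [ray x y] is the ray from [x] through [y], [bd] is the boundary of the
   domain and [len] is the quantity whose ratio occurs in the logarithm.  The
   default value [x] of [xget] is never used in [funk]. *)
Definition exit_point ray bd (x y : T) : T := xget x (ray x y `&` bd).

Definition funk ray bd len (x y : T) : R :=
  if `[< x <> y /\ (ray x y `&` bd) !=set0 >]
  then let b := exit_point ray bd x y in ln (len x b / len y b)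
  else 0.

Definition hilbert ray bd len (x y : T) : R :=
  (funk ray bd len x y + funk ray bd len y x) / 2.

Definition is_isometry (A : set T) (distA : T -> T -> R)
    (B : set T) (distB : T -> T -> R) (f : T -> T) : Prop :=
  set_bij A B f /\
  forall x y, A x -> A y -> distB (f x) (f y) = distA x y.

End FunkHilbert.

(* Topological boundary of [A] as a subset of the space [X], where [X] carries
   the subspace topology; meant for [A `<=` X]. *)
Definition frontier_in {T : topologicalType} (X A : set T) : set T :=
  closure (A : set (subspace X)) `\` interior (A : set (subspace X)).

Section Geometry.
Context {R : realType} {n : nat}.
Implicit Types (x y z u v : 'rV[R]_n.+1) (Om D : set 'rV[R]_n.+1).

(* The coordinate x_{n+1}. *)
Definition height x : R := x 0 ord_max.

Definition minkowski x y : R :=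
  \sum_(i < n) x 0 (lift ord_max i) * y 0 (lift ord_max i)
  - height x * height y.

Definition hyperboloid : set 'rV[R]_n.+1 :=
  [set x | minkowski x x = -1 /\ 0 < height x].

Definition arcosh (t : R) : R := ln (t + Num.sqrt (t ^+ 2 - 1)).
Definition sinh (t : R) : R := (expR t - expR (- t)) / 2.

Definition hdist x y : R := arcosh (- minkowski x y).

(* Unit-speed (minimizing) geodesics of the hyperboloid, parametrized by I. *)
Definition hgeodesic (I : set R) (g : R -> 'rV[R]_n.+1) : Prop :=
  forall s t, I s -> I t ->
    hyperboloid (g s) /\ hdist (g s) (g t) = `|s - t|.

Definition hsegment x y : set 'rV[R]_n.+1 :=
  [set z | exists g, [/\ hgeodesic `[0, hdist x y]%classic g,
     g 0 = x, g (hdist x y) = y & (g @` `[0, hdist x y]%classic) z]].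

Definition hray x y : set 'rV[R]_n.+1 :=
  [set z | exists g, [/\ hgeodesic `[0, +oo[%classic g,
     g 0 = x, (g @` `[0, +oo[%classic) y & (g @` `[0, +oo[%classic) z]].

Definition hconvex Om : Prop :=
  forall x y, Om x -> Om y -> hsegment x y `<=` Om.

Definition hhilbert Om : 'rV[R]_n.+1 -> 'rV[R]_n.+1 -> R :=
  hilbert hray (frontier_in hyperboloid Om) (fun x y => sinh (hdist x y)).

(* The affine hyperplane x_{n+1} = 1. *)
Definition hyperplane : set 'rV[R]_n.+1 := [set x | height x = 1].

Definition vproj x : 'rV[R]_n.+1 := (height x)^-1 *: x.

(* The library norm on row vectors is the sup norm. *)
Definition edist u v : R := Num.sqrt (\sum_i (u 0 i - v 0 i) ^+ 2).

Definition eray u v : set 'rV[R]_n.+1 :=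
  [set u + t *: (v - u) | t in `[0, +oo[%classic].

(* [D] is meant to be a subset of [hyperplane]. *)
Definition ehilbert D : 'rV[R]_n.+1 -> 'rV[R]_n.+1 -> R :=
  hilbert eray (frontier_in hyperplane D) edist.

End Geometry.

Arguments hyperboloid {R n}.
Arguments hyperplane {R n}.

(* Main.v *)
From mathcomp Require Import all_boot all_order all_algebra.
From mathcomp Require Import all_classical all_reals all_analysis.
From mathcomp Require Import ring lra.
(* Imported last so that [minkowski] is the bilinear form and not the
   inequality between Lebesgue norms. *)
Require Import Defs.
Import Order.TTheory GRing.Theory Num.Theory.
Import numFieldNormedType.Exports.
Local Open Scope classical_set_scope.
Local Open Scope ring_scope.

(** The projection carries hyperbolic geodesics to straight lines, because a
    geodesic is the trace on the hyperboloid of a plane through the origin.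
    Concretely, a point [b] of the ray from [x] through [y] has the form
    [a *: x + c *: y] with [0 <= c] ([hray_comb]), and [vproj b] is then the
    point of the Euclidean ray with parameter [c * height y / height b]
    ([vproj_comb]).

    Two quantities are read off from this form. Comparing Gram determinants,
    [sinh (hdist x b)] and [sinh (hdist y b)] are [c] and [`|a|] times
    [sinh (hdist x y)] ([sinh_hdist_comb]), so the ratio in the hyperbolic Funk
    metric is [c / `|a|]. The corresponding Euclidean ratio is
    [c * height y / (`|a| * height x)]. Hence the Funk metrics differ by
    [ln (height y) - ln (height x)] ([funk_vproj]). This changes sign when [x]
    and [y] are exchanged and disappears from the Hilbert metric
    ([hilbert_vproj]).

    For this comparison [vproj] must send the exit point of the hyperbolic ray
    to the exit point of the Euclidean ray. Boundary points go to boundary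
    points ([frontier_in_vproj]), since [vproj] is a homeomorphism from the
    hyperboloid onto an open disc of the hyperplane, with inverse [hlift]; and a
    Euclidean ray issued from an open convex set has at most one boundary point
    ([eray_frontier_unique]). The image is convex because the hyperbolic
    segment from [x] to [y] contains the normalization of every nonnegative
    combination of [x] and [y] ([hsegment_hlift_comb]).

    The rays in the definitions are given by arbitrary unit-speed geodesics, so
    [hray_comb] includes the uniqueness of geodesics: equality in the triangle
    inequality places three points of the hyperboloid in one plane. *)

(** * Hyperbolic functions *)

Section HyperbolicFunctions.
Context {R : realType}.
Implicit Types s t c : R.

Definition cosh t : R := (expR t + expR (- t)) / 2.

Lemma coshN t : cosh (- t) = cosh t.
Proof. by rewrite /cosh opprK addrC. Qed.

Lemma sinhN t : sinh (- t) = - sinh t.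
Proof. by rewrite /sinh opprK; ring. Qed.

Lemma sinh0 : sinh 0 = 0 :> R.
Proof. by rewrite /sinh oppr0 subrr mul0r. Qed.

Lemma cosh0 : cosh 0 = 1.
Proof. by rewrite /cosh oppr0 expR0; field. Qed.

Lemma cosh_norm t : cosh `|t| = cosh t.
Proof. by case: (ger0P t) => _ //; rewrite coshN. Qed.

Lemma coshD_sinh t : cosh t + sinh t = expR t.
Proof. by rewrite /cosh /sinh; field. Qed.

Lemma cosh2Bsinh2 t : cosh t ^+ 2 - sinh t ^+ 2 = 1.
Proof.
rewrite /cosh /sinh expRN; field.
by rewrite gt_eqF// expR_gt0.
Qed.

Lemma coshB s t : cosh (s - t) = cosh s * cosh t - sinh s * sinh t.
Proof.
rewrite /cosh /sinh opprB !expRD !expRN; field.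
by rewrite !gt_eqF ?expR_gt0.
Qed.

Lemma sinhB s t : sinh (s - t) = sinh s * cosh t - cosh s * sinh t.
Proof.
rewrite /cosh /sinh opprB !expRD !expRN; field.
by rewrite !gt_eqF ?expR_gt0.
Qed.

Lemma sinh_ge0 t : 0 <= t -> 0 <= sinh t.
Proof. by move=> t0; rewrite divr_ge0// subr_ge0 ler_expR; lra. Qed.

Lemma sinh_gt0 t : 0 < t -> 0 < sinh t.
Proof. by move=> t0; rewrite divr_gt0// subr_gt0 ltr_expR; lra. Qed.

Lemma coshK t : 0 <= t -> arcosh (cosh t) = t.
Proof.
move=> t0; rewrite /arcosh.
have -> : cosh t ^+ 2 - 1 = sinh t ^+ 2 by have := cosh2Bsinh2 t; lra.
by rewrite sqrtr_sqr ger0_norm ?sinh_ge0// coshD_sinh expRK.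
Qed.

Lemma expR_arcosh c : 1 <= c -> expR (arcosh c) = c + Num.sqrt (c ^+ 2 - 1).
Proof.
move=> c1; rewrite lnK// posrE.
by have := sqrtr_ge0 (c ^+ 2 - 1); lra.
Qed.

Lemma expR_Narcosh c : 1 <= c -> expR (- arcosh c) = c - Num.sqrt (c ^+ 2 - 1).
Proof.
move=> c1; rewrite expRN expR_arcosh//.
have r0 := sqrtr_ge0 (c ^+ 2 - 1).
have u0 : c + Num.sqrt (c ^+ 2 - 1) != 0 by rewrite gt_eqF//; lra.
apply: (mulfI u0); rewrite divff// mulrC -subr_sqr sqr_sqrtr; last by nra.
by ring.
Qed.

Lemma arcoshK c : 1 <= c -> cosh (arcosh c) = c.
Proof. by move=> c1; rewrite /cosh expR_Narcosh// expR_arcosh//; field. Qed.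

Lemma sinh_arcosh c : 1 <= c -> sinh (arcosh c) = Num.sqrt (c ^+ 2 - 1).
Proof. by move=> c1; rewrite /sinh expR_Narcosh// expR_arcosh//; field. Qed.

Lemma arcosh_ge0 c : 1 <= c -> 0 <= arcosh c.
Proof. by move=> c1; rewrite ln_ge0//; have := sqrtr_ge0 (c ^+ 2 - 1); lra. Qed.

End HyperbolicFunctions.

(** * The Minkowski form *)

Section HyperboloidModel.
Context {R : realType} {n : nat}.
Implicit Types (x y z u v w : 'rV[R]_n.+1) (a b c k t : R).
Implicit Types (Om D X A : set 'rV[R]_n.+1).

Lemma heightD x y : height (x + y) = height x + height y.
Proof. by rewrite /height mxE. Qed.

Lemma heightZ a x : height (a *: x) = a * height x.
Proof. by rewrite /height mxE. Qed.

Lemma heightN x : height (- x) = - height x.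
Proof. by rewrite /height mxE. Qed.

Lemma minkowskiC x y : minkowski x y = minkowski y x.
Proof.
rewrite /minkowski [height x * _]mulrC.
by under eq_bigr do rewrite mulrC.
Qed.

Lemma minkowskiDl x y z : minkowski (x + y) z = minkowski x z + minkowski y z.
Proof.
rewrite /minkowski heightD; under eq_bigr do rewrite mxE mulrDl.
by rewrite big_split /=; ring.
Qed.

Lemma minkowskiZl a x z : minkowski (a *: x) z = a * minkowski x z.
Proof.
rewrite /minkowski heightZ; under eq_bigr do rewrite mxE -mulrA.
by rewrite -mulr_sumr; ring.
Qed.

Lemma minkowskiDr x y z : minkowski z (x + y) = minkowski z x + minkowski z y.
Proof. by rewrite !(minkowskiC z) minkowskiDl. Qed.

Lemma minkowskiZr a x z : minkowski z (a *: x) = a * minkowski z x.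
Proof. by rewrite !(minkowskiC z) minkowskiZl. Qed.

Definition minkowskiE :=
  (minkowskiDl, minkowskiDr, minkowskiZl, minkowskiZr).

Lemma minkowski_height0_ge0 v : height v = 0 -> 0 <= minkowski v v.
Proof.
move=> v0; rewrite /minkowski v0 mul0r subr0.
by apply: sumr_ge0 => i _; rewrite -expr2 sqr_ge0.
Qed.

Lemma minkowski_height0_eq0 v : height v = 0 -> minkowski v v = 0 -> v = 0.
Proof.
rewrite /minkowski => v0; rewrite v0 mul0r subr0 => /eqP.
rewrite psumr_eq0 => [/allP vi0|i _]; last by rewrite -expr2 sqr_ge0.
apply/rowP => j; rewrite mxE; case: (unliftP ord_max j) => [i ->|-> //].
by have := vi0 i (mem_index_enum _); rewrite mulf_eq0 orbb => /eqP.
Qed.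

(** Subtracting the right multiple of a timelike vector [x] makes any vector
    horizontal, and on horizontal vectors the form is Euclidean. *)
Lemma minkowski_perp_eq0 x w : height x != 0 -> minkowski x x < 0 ->
  minkowski x w = 0 -> minkowski w w = 0 -> w = 0.
Proof.
move=> hx xx xw ww.
pose v := height x *: w + (- height w) *: x.
have hv : height v = 0 by rewrite /v heightD !heightZ; ring.
have vv : minkowski v v = height w ^+ 2 * minkowski x x.
  by rewrite /v !minkowskiE (minkowskiC w) xw ww; ring.
have w0 : height w = 0.
  apply/eqP; rewrite -[_ == _]negbK; apply/negP => hw.
  have := minkowski_height0_ge0 v hv; rewrite vv leNgt pmulr_rlt0 ?xx//.
  by rewrite exprn_even_gt0.
exact: minkowski_height0_eq0.
Qed.

(** Reversed Cauchy-Schwarz inequality: the form is nonnegative on the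
    horizontal vector [height x *: y - height y *: x], which gives
    [height x ^+ 2 + height y ^+ 2 <= - 2 * height x * height y *
    minkowski x y]. *)
Lemma hyperboloid_minkowski_le x y :
  hyperboloid x -> hyperboloid y -> 1 <= - minkowski x y.
Proof.
move=> [xx hx] [yy hy].
pose v := height x *: y + (- height y) *: x.
have hv : height v = 0 by rewrite /v heightD !heightZ; ring.
have := minkowski_height0_ge0 v hv.
rewrite /v !minkowskiE (minkowskiC y x) xx yy => vv.
have hxy : 0 < height x * height y by rewrite mulr_gt0.
rewrite -(ler_pM2l hxy).
have := sqr_ge0 (height x - height y); lra.
Qed.

Lemma hyperboloid_minkowskiN1 x y :
  hyperboloid x -> hyperboloid y -> minkowski x y = -1 -> x = y.
Proof.
move=> [xx hx] [yy hy] xy; apply/eqP; rewrite -subr_eq0; apply/eqP.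
apply: (minkowski_perp_eq0 x); rewrite ?gt_eqF// ?xx ?ltrN10//;
  by rewrite -scaleN1r !minkowskiE ?(minkowskiC y x) xx ?yy xy; ring.
Qed.

Lemma cosh_hdist x y :
  hyperboloid x -> hyperboloid y -> cosh (hdist x y) = - minkowski x y.
Proof. by move=> Hx Hy; rewrite arcoshK// hyperboloid_minkowski_le. Qed.

Lemma sinh_hdist x y : hyperboloid x -> hyperboloid y ->
  sinh (hdist x y) = Num.sqrt (minkowski x y ^+ 2 - 1).
Proof.
by move=> Hx Hy; rewrite sinh_arcosh ?sqrrN// hyperboloid_minkowski_le.
Qed.

Lemma hdist_gt0 x y :
  hyperboloid x -> hyperboloid y -> x <> y -> 0 < hdist x y.
Proof.
move=> Hx Hy xy; rewrite lt0r arcosh_ge0 ?hyperboloid_minkowski_le// andbT.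
apply/eqP => d0; apply: xy; apply: hyperboloid_minkowskiN1 => //.
by have := cosh_hdist _ _ Hx Hy; rewrite d0 cosh0; lra.
Qed.

Lemma hdistC x y : hdist x y = hdist y x.
Proof. by rewrite /hdist minkowskiC. Qed.

(** For two points of the hyperboloid, [sinh (hdist x y) ^+ 2] is up to sign
    their Gram determinant, and replacing [y] by [a *: x + c *: y] multiplies
    this determinant by [c ^+ 2]. *)
Lemma sinh_hdist_comb x y z a c :
  hyperboloid x -> hyperboloid y -> hyperboloid z -> z = a *: x + c *: y ->
  sinh (hdist x z) = `|c| * sinh (hdist x y).
Proof.
move=> Hx Hy Hz zE; rewrite !sinh_hdist// -sqrtr_sqr -sqrtrM ?sqr_ge0//.
congr Num.sqrt.
have [[[xx _] [yy _]] [zz _]] := (Hx, Hy, Hz).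
have : minkowski x z ^+ 2 - minkowski x x * minkowski z z =
    c ^+ 2 * (minkowski x y ^+ 2 - minkowski x x * minkowski y y).
  by rewrite zE !minkowskiE (minkowskiC y x); ring.
by rewrite xx yy zz mulrNN mulr1.
Qed.

(** * Hyperbolic rays *)

Lemma hgeodesic_minkowski I (g : R -> 'rV[R]_n.+1) s t :
  hgeodesic I g -> I s -> I t -> minkowski (g s) (g t) = - cosh (s - t).
Proof.
move=> gI Is It; have [Hs st] := gI s t Is It; have [Ht _] := gI t t It It.
by apply/eqP; rewrite -eqr_oppLR -cosh_hdist// st cosh_norm.
Qed.

(** The point at parameter [t] has the same products with [x], [y] and itself
    as the vector [z'] of the plane of [x] and [y] with coefficients
    [sinh (d - t) / sinh d] and [sinh t / sinh d], so the difference is a null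
    vector orthogonal to the timelike [x]. *)
Lemma hray_comb x y z : hyperboloid x -> x <> y -> hray x y z ->
  hyperboloid z /\ exists a c, 0 <= c /\ z = a *: x + c *: y.
Proof.
move=> Hx xy [g [gI g0 [d /= d0 gd] [t /= t0 gt]]].
have I0 : `[0, +oo[%classic (0 : R) by rewrite /= in_itv/= lexx.
have [Hz _] := gI _ _ t0 t0; have [Hy _] := gI _ _ d0 d0.
have mg s s' : `[0, +oo[%classic s -> `[0, +oo[%classic s' ->
    minkowski (g s) (g s') = - cosh (s - s').
  exact: hgeodesic_minkowski gI.
have xz : minkowski x z = - cosh t by rewrite -g0 -gt mg// sub0r coshN.
have xyE : minkowski x y = - cosh d by rewrite -g0 -gd mg// sub0r coshN.
have yz : minkowski y z = - (cosh d * cosh t - sinh d * sinh t).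
  by rewrite -gd -gt mg// coshB.
rewrite gt in Hz; rewrite gd in Hy.
have [[[xx hx] [yy _]] [zz _]] := (Hx, Hy, Hz).
rewrite !in_itv/= !andbT in d0 t0.
have dp : 0 < d.
  rewrite lt0r d0 andbT; apply/eqP => dE.
  by apply: xy; rewrite -g0 -dE gd.
have S0 := sinh_gt0 _ dp; have Sn0 : sinh d != 0 by rewrite gt_eqF.
split=> //; exists (sinh (d - t) / sinh d), (sinh t / sinh d).
split; first by rewrite divr_ge0 ?sinh_ge0.
have Cd := cosh2Bsinh2 d; have Ct := cosh2Bsinh2 t.
set z' := _ + _.
have Cd' : cosh d ^+ 2 = 1 + sinh d ^+ 2 by lra.
have Ct' : cosh t ^+ 2 = 1 + sinh t ^+ 2 by lra.
have xz' : minkowski x z' = - cosh t.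
  rewrite /z' !minkowskiE xx xyE sinhB; field: Cd' => //.
have yz' : minkowski y z' = minkowski y z.
  rewrite /z' !minkowskiE yy minkowskiC xyE yz sinhB; field: Cd' => //.
have zz' : minkowski z z' = -1.
  rewrite /z' !minkowskiE !(minkowskiC z) xz yz sinhB; field: Cd' Ct' => //.
have combE v : minkowski z' v =
    sinh (d - t) / sinh d * minkowski x v + sinh t / sinh d * minkowski y v.
  by rewrite /z' minkowskiDl !minkowskiZl.
have z'z' : minkowski z' z' = -1.
  by rewrite -zz' (minkowskiC z) !combE xz' yz' xz.
clearbody z'.
apply/eqP; rewrite -subr_eq0; apply/eqP.
apply: (minkowski_perp_eq0 x); rewrite ?gt_eqF ?xx ?ltrN10// -scaleN1r.
  by rewrite !minkowskiE xz xz'; ring.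
by rewrite !minkowskiE (minkowskiC z' z) zz zz' z'z'; ring.
Qed.

(** * The projection from the origin *)

(** The radial retraction of the future timelike cone onto the hyperboloid;
    on the disc of the hyperplane it is the inverse of the projection. *)
Definition hlift v : 'rV[R]_n.+1 := (Num.sqrt (- minkowski v v))^-1 *: v.

Lemma hlift_hyperboloid v :
  minkowski v v < 0 -> 0 < height v -> hyperboloid (hlift v).
Proof.
move=> vv hv; have vv' : 0 < - minkowski v v by rewrite oppr_gt0.
split; last by rewrite heightZ mulr_gt0// invr_gt0 sqrtr_gt0.
rewrite /hlift minkowskiZl minkowskiZr mulrA -invfM -expr2 sqr_sqrtr ?ltW//.
by rewrite invrN mulNr mulVf// lt_eqF.
Qed.

Lemma vprojZ k v : k != 0 -> vproj (k *: v) = vproj v.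
Proof.
by move=> k0; rewrite /vproj heightZ scalerA invfM mulrAC mulVf// mul1r.
Qed.

Lemma vproj_hlift v : minkowski v v < 0 -> vproj (hlift v) = vproj v.
Proof.
by move=> vv; rewrite vprojZ// invr_neq0// gt_eqF// sqrtr_gt0 oppr_gt0.
Qed.

Lemma height_vproj v : height v != 0 -> height (vproj v) = 1.
Proof. by move=> v0; rewrite heightZ mulVf. Qed.

Lemma vproj_hyperplane v : hyperplane v -> vproj v = v.
Proof. by move=> v1; rewrite /vproj v1 invr1 scale1r. Qed.

Lemma minkowski_vproj x :
  hyperboloid x -> minkowski (vproj x) (vproj x) = - (height x)^-1 ^+ 2.
Proof. by move=> [xx hx]; rewrite minkowskiZl minkowskiZr xx; ring. Qed.

Lemma minkowski_vproj_lt0 x :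
  hyperboloid x -> minkowski (vproj x) (vproj x) < 0.
Proof.
move=> Hx; rewrite minkowski_vproj// oppr_lt0 exprn_gt0// invr_gt0.
by case: Hx.
Qed.

Lemma vprojK x : hyperboloid x -> hlift (vproj x) = x.
Proof.
move=> Hx; have [_ hx] := Hx.
rewrite /hlift minkowski_vproj// opprK sqrtr_sqr ger0_norm ?invr_ge0 ?ltW//.
by rewrite invrK /vproj scalerA mulfV ?scale1r// gt_eqF.
Qed.

Lemma vproj_inj x y :
  hyperboloid x -> hyperboloid y -> vproj x = vproj y -> x = y.
Proof. by move=> Hx Hy xy; rewrite -(vprojK x)// xy vprojK. Qed.

(** Dividing [z] by its height turns its coefficients on [x] and [y] into the
    weights [a * height x / height z] and [c * height y / height z] on
    [vproj x] and [vproj y], and these add up to [1]. *)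
Lemma vproj_comb x y z a c : height x != 0 -> height y != 0 ->
  height z != 0 -> z = a *: x + c *: y ->
  vproj z = vproj x + (c * height y / height z) *: (vproj y - vproj x).
Proof.
move=> hx hy hz zE; have hzE : a * height x = height z - c * height y.
  by rewrite zE heightD !heightZ addrK.
have -> : vproj z = (a * height x / height z) *: vproj x
    + (c * height y / height z) *: vproj y.
  rewrite {1}/vproj {2}zE scalerDr /vproj !scalerA.
  by congr (_ *: _ + _ *: _); field; rewrite ?hx ?hy ?hz.
rewrite hzE mulrBl divff// scalerBl scale1r scalerBr.
by rewrite -addrA [- _ + _]addrC.
Qed.

(** * Hyperbolic segments *)

(** The normalized combination lies at distance [s] from [x], and the addition
    formula recovers its coefficients as [sinh (d - s) / sinh d] and
    [sinh s / sinh d]. *)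
Lemma hsegment_hlift_comb x y a b :
  hyperboloid x -> hyperboloid y -> x <> y -> 0 <= a -> 0 <= b -> 0 < a + b ->
  minkowski (a *: x + b *: y) (a *: x + b *: y) < 0 /\
  hsegment x y (hlift (a *: x + b *: y)).
Proof.
move=> Hx Hy xy a0 b0 ab0.
have [[xx hx] [yy hy]] := (Hx, Hy).
have xy1 := hyperboloid_minkowski_le x y Hx Hy.
set v := a *: x + b *: y.
have vv : minkowski v v < 0.
  rewrite /v !minkowskiE (minkowskiC y x) xx yy.
  have ab1 : 0 <= a * b * (- minkowski x y - 1) by rewrite !mulr_ge0// subr_ge0.
  have := exprn_gt0 2 ab0; lra.
have hv : 0 < height v.
  rewrite /v heightD !heightZ.
  have [a1|a1] := eqVneq a 0.
    by rewrite a1 mul0r add0r mulr_gt0//; move: ab0; rewrite a1 add0r.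
  by rewrite ltr_pwDl//; [rewrite mulr_gt0// lt0r a1|rewrite mulr_ge0// ltW].
split=> //; have Hz := hlift_hyperboloid v vv hv.
set k := (Num.sqrt (- minkowski v v))^-1.
have k0 : 0 < k by rewrite invr_gt0 sqrtr_gt0 oppr_gt0.
have zE : hlift v = (k * a) *: x + (k * b) *: y.
  by rewrite /hlift -/k scalerDr !scalerA.
set z := hlift v in zE Hz *; clearbody z.
set d := hdist x y.
have d0 : 0 < d by exact: hdist_gt0.
have S0 := sinh_gt0 d d0; have Sn0 : sinh d != 0 by rewrite gt_eqF.
have xyd : minkowski x y = - cosh d by rewrite /d cosh_hdist// opprK.
have Cd : cosh d ^+ 2 = 1 + sinh d ^+ 2 by have := cosh2Bsinh2 d; lra.
set s := hdist x z.
have s0 : 0 <= s by rewrite arcosh_ge0// hyperboloid_minkowski_le.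
have sE : sinh s = k * b * sinh d.
  rewrite /s (sinh_hdist_comb x y z (k * a) (k * b))// ger0_norm//.
  by rewrite mulr_ge0// ltW.
have csE : cosh s = k * a + k * b * cosh d.
  by rewrite /s cosh_hdist// zE !minkowskiE xx xyd; ring.
have dsE : sinh (d - s) = k * a * sinh d by rewrite sinhB sE csE; ring.
have sd : s <= d.
  rewrite leNgt; apply/negP => ds.
  have := sinh_gt0 (s - d); rewrite subr_gt0 => /(_ ds).
  rewrite -opprB sinhN dsE oppr_gt0 ltNge.
  by rewrite (mulr_ge0 (mulr_ge0 (ltW k0) a0) (ltW S0)).
pose g t := (sinh (d - t) / sinh d) *: x + (sinh t / sinh d) *: y.
have gg t t' : minkowski (g t) (g t') = - cosh (t - t').
  rewrite /g !minkowskiE (minkowskiC y x) xx yy xyd !sinhB coshB.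
  by field: Cd.
exists g; split.
- move=> t t' /=; rewrite !in_itv/= => /andP[t0 td] _.
  split; last by rewrite /hdist gg opprK -cosh_norm coshK.
  split; first by rewrite gg subrr cosh0.
  rewrite /g heightD !heightZ.
  have [->|t1] := eqVneq t 0.
    by rewrite subr0 sinh0 mul0r mul0r addr0 divff// mul1r.
  have sr : 0 <= sinh (d - t) by rewrite sinh_ge0// subr_ge0.
  have st : 0 < sinh t by rewrite sinh_gt0// lt0r t1.
  apply: ltr_wpDl; first exact: mulr_ge0 (divr_ge0 sr (ltW S0)) (ltW hx).
  exact: mulr_gt0 (divr_gt0 st S0) hy.
- by rewrite /g subr0 sinh0 mul0r scale0r addr0 divff// scale1r.
- by rewrite /g subrr sinh0 mul0r scale0r add0r divff// scale1r.
- exists s; first by rewrite /= in_itv/= s0.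
  by rewrite /g dsE sE zE !mulfK.
Qed.

(** * Images of open convex sets *)

Lemma vproj_image_sub Om : Om `<=` hyperboloid -> vproj @` Om `<=` hyperplane.
Proof.
move=> OmH _ [x /OmH[_ hx] <-].
by rewrite /hyperplane /= height_vproj// gt_eqF.
Qed.

Lemma vproj_image_convex Om : Om `<=` hyperboloid -> hconvex Om ->
  convex_set (vproj @` Om : set (convex_lmodType 'rV[R]_n.+1)).
Proof.
move=> OmH Omc _ _ l /set_mem[x Ox <-] /set_mem[y Oy <-]; apply/mem_set.
have [Hx Hy] := (OmH x Ox, OmH y Oy); have [[_ hx] [_ hy]] := (Hx, Hy).
have [xy|xy] := pselect (x = y).
  by exists x => //; rewrite -xy convmm.
have l0 : 0 <= l%:inum :> R by [].
have l1 : l%:inum <= 1 :> R by [].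
set a := l%:inum / height x; set b := (1 - l%:inum) / height y.
have a0 : 0 <= a by rewrite divr_ge0// ltW.
have b0 : 0 <= b by rewrite divr_ge0 ?subr_ge0// ltW.
have hab : a * height x + b * height y = 1.
  by rewrite /a /b !divfK ?gt_eqF//; ring.
have ab0 : 0 < a + b.
  rewrite lt0r addr_ge0// andbT; apply/eqP => ab; move: hab.
  have -> : a = 0 by lra.
  have -> : b = 0 by lra.
  by rewrite !mul0r addr0 => /eqP; rewrite eq_sym oner_eq0.
have [vv seg] := hsegment_hlift_comb x y a b Hx Hy xy a0 b0 ab0.
exists (hlift (a *: x + b *: y)); first exact: Omc seg.
rewrite vproj_hlift// vproj_hyperplane; last first.
  by rewrite /hyperplane /= heightD !heightZ hab.
by rewrite /conv /= /vproj !scalerA.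
Qed.

Lemma height_continuous : continuous (@height R n).
Proof. by move=> x; exact: coord_continuous. Qed.

Lemma minkowski_continuous : continuous (fun v => minkowski v v).
Proof.
move=> v; rewrite /minkowski.
apply: (@cvgB _ _ _ (nbhs v)); last by apply: cvgM; exact: height_continuous.
apply: (cvg_big (op := +%R)); first exact: add_continuous.
by move=> i _; apply: cvgM; exact: coord_continuous.
Qed.

Lemma vproj_continuous v : height v != 0 -> {for v, continuous vproj}.
Proof.
move=> v0; apply: (@cvgZ _ _ _ (nbhs v)); last exact: cvg_id.
by apply: (@cvgV _ _ (nbhs v)) => //; exact: height_continuous.
Qed.

Lemma hlift_continuous v : minkowski v v < 0 -> {for v, continuous hlift}.
Proof.
move=> vv; apply: (@cvgZ _ _ _ (nbhs v)); last exact: cvg_id.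
apply: (@cvgV _ _ (nbhs v)); first by rewrite gt_eqF// sqrtr_gt0 oppr_gt0.
apply: (continuous_comp (f := fun v => - minkowski v v) (g := Num.sqrt)).
  by apply: (@cvgN _ _ _ (nbhs v)); exact: minkowski_continuous.
exact: sqrt_continuous.
Qed.

Lemma vproj_image_open Om : Om `<=` hyperboloid ->
  open (Om : set (subspace hyperboloid)) ->
  open (vproj @` Om : set (subspace hyperplane)).
Proof.
move=> OmH /open_subspaceP[U oU UOm].
have UOmE v : U v -> hyperboloid v -> Om v.
  by move=> Uv Hv; have : (U `&` hyperboloid) v by []; rewrite UOm => -[].
have OmU v : Om v -> U v.
  move=> Ov; have : (Om `&` hyperboloid) v by split => //; exact: OmH.
  by rewrite -UOm => -[].
apply/open_subspaceP.
(* The preimage of [U] by the inverse [hlift] of the projection, which is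
   continuous on the open timelike cone. *)
exists [set v | [/\ minkowski v v < 0, 0 < height v & U (hlift v)]].
  rewrite openE => v /= [vv hv Uv].
  have nU : nbhs (hlift v) U by exact: open_nbhs_nbhs.
  have n1 : \forall w \near v, minkowski w w < 0.
    exact: cvgr_lt (minkowski_continuous v) 0 vv.
  have n2 : \forall w \near v, 0 < height w.
    exact: cvgr_gt (height_continuous v) 0 hv.
  have n3 : \forall w \near v, U (hlift w) by exact: hlift_continuous nU.
  rewrite /interior /=; near=> w.
  by split; near: w; [exact: n1|exact: n2|exact: n3].
rewrite eqEsubset; split=> [v [[vv hv Uv] v1]|_ [[x Ox <-] Px]].
  split=> //; exists (hlift v).
    by apply: UOmE => //; exact: hlift_hyperboloid.
  by rewrite vproj_hlift// vproj_hyperplane.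
have Hx := OmH x Ox.
split=> //; split; [exact: minkowski_vproj_lt0| |].
  by rewrite Px ltr01.
by rewrite vprojK//; exact: OmU.
Unshelve. all: by end_near. Qed.

(** * Boundary points *)

Lemma frontier_in_openE X A : A `<=` X -> open (A : set (subspace X)) ->
  frontier_in X A = (closure A `&` X) `\` A.
Proof.
by move=> AX /interior_id oA; rewrite /frontier_in oA closure_subspaceW.
Qed.

Lemma frontier_in_vproj Om x : Om `<=` hyperboloid ->
  open (Om : set (subspace hyperboloid)) ->
  frontier_in hyperboloid Om x ->
  frontier_in hyperplane (vproj @` Om) (vproj x).
Proof.
move=> OmH oOm; rewrite !frontier_in_openE//; last 2 first.
  exact: vproj_image_sub.
  exact: vproj_image_open.
move=> [[clx Hx] nOx]; have [_ hx] := Hx.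
have hx0 : height x != 0 by rewrite gt_eqF.
split; last first.
  by move=> [y Oy /vproj_inj yx]; apply: nOx; rewrite -yx//; exact: OmH.
split; last by rewrite /hyperplane /= height_vproj.
move=> B /(vproj_continuous x hx0) /clx[y [Oy By]].
by exists (vproj y); split => //; exists y.
Qed.

(** Let [b] be the point to be placed in [D]. The homothety [f] centred at [b]
    that sends [w] to [u] sends some [v] in [D] near [w] to a point near [u],
    hence in [D], and [b] lies between [v] and [f v]. *)
Lemma convex_open_ray D u w t : D `<=` hyperplane ->
  open (D : set (subspace hyperplane)) ->
  convex_set (D : set (convex_lmodType 'rV[R]_n.+1)) ->
  D u -> hyperplane w -> closure D w -> 0 <= t < 1 -> D (u + t *: (w - u)).
Proof.
move=> DX /open_subspaceP[U oU UD] Dc Du hw clw /andP[t0 t1].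
have UDE v : U v -> hyperplane v -> D v.
  by move=> Uv Hv; have : (U `&` hyperplane) v by []; rewrite UD => -[].
have Uu : U u.
  have : (D `&` hyperplane) u by split => //; exact: DX.
  by rewrite -UD => -[].
have s0 : 1 - t != 0 by rewrite subr_eq0 gt_eqF.
pose b := u + t *: (w - u).
pose f v := (1 - t)^-1 *: (b - t *: v).
have fw : f w = u by apply/rowP => j; rewrite !mxE; field.
have nU : nbhs (f w) U by rewrite fw; exact: open_nbhs_nbhs.
have fc : {for w, continuous f}.
  apply: (@cvgZl_tmp _ _ _ (nbhs w)); apply: cvgB; first exact: cvg_cst.
  by apply: cvgZl_tmp; exact: cvg_id.
have [v [Dv Uv]] := clw _ (fc _ nU).
have Dfv : D (f v).
  apply: (UDE _ Uv); rewrite /hyperplane /= /f /b.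
  rewrite !(heightD, heightN, heightZ) hw (DX _ Du) (DX _ Dv).
  by field.
have -> : u + t *: (w - u) = t *: v + (1 - t) *: f v.
  by apply/rowP => j; rewrite !mxE; field.
have := Dc v (f v) (Itv01 t0 (ltW t1)) (mem_set Dv) (mem_set Dfv).
by move=> /set_mem.
Qed.

Lemma eray_frontier_unique D u v w w' : D `<=` hyperplane ->
  open (D : set (subspace hyperplane)) ->
  convex_set (D : set (convex_lmodType 'rV[R]_n.+1)) -> D u ->
  (eray u v `&` frontier_in hyperplane D) w ->
  (eray u v `&` frontier_in hyperplane D) w' -> w = w'.
Proof.
move=> DX oD Dc Du; rewrite frontier_in_openE//.
move=> [[t /= t0 tw] [[clw Xw] nDw]] [[t' /= t'0 tw'] [[clw' Xw'] nDw']].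
have between s s' z z' : 0 <= s -> s < s' -> u + s *: (v - u) = z ->
    u + s' *: (v - u) = z' -> hyperplane z' -> closure D z' -> D z.
  move=> s0 ss' <- <- Xz clz; have s'0 : 0 < s' by exact: le_lt_trans ss'.
  have ss1 : 0 <= s / s' < 1.
    by rewrite divr_ge0 ?(ltW s'0)//= ltr_pdivrMr// mul1r.
  have := convex_open_ray D u _ (s / s') DX oD Dc Du Xz clz ss1.
  by rewrite addrAC subrr add0r scalerA divfK ?gt_eqF.
rewrite !in_itv/= !andbT in t0 t'0.
have [tt'|tt'|tt'] := ltgtP t t'; last by rewrite -tw -tw' tt'.
  by case: nDw; exact: (between t t' w w').
by case: nDw'; exact: (between t' t w' w).
Qed.

(** * Comparison of the Funk and Hilbert metrics *)

Lemma edist_scale u v u' v' c :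
  u - v = c *: (u' - v') -> edist u v = `|c| * edist u' v'.
Proof.
move=> uvE; rewrite /edist -sqrtr_sqr -sqrtrM ?sqr_ge0// mulr_sumr.
congr Num.sqrt; apply: eq_bigr => i _.
by have /rowP/(_ i) := uvE; rewrite !mxE => ->; rewrite exprMn.
Qed.

Lemma edistC u v : edist u v = edist v u.
Proof.
by rewrite (edist_scale u v v u (-1)) ?normrN1 ?mul1r// scaleN1r opprB.
Qed.

Lemma edist_gt0 u v : u <> v -> 0 < edist u v.
Proof.
move=> uv; rewrite sqrtr_gt0 lt0r sumr_ge0 ?andbT; last first.
  by move=> i _; exact: sqr_ge0.
apply/negP; rewrite psumr_eq0 => [/allP uv0|i _]; last exact: sqr_ge0.
apply: uv; apply/rowP => i; apply/eqP.
by have := uv0 i (mem_index_enum _); rewrite sqrf_eq0 subr_eq0.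
Qed.

Lemma funkE ray (bd : set 'rV[R]_n.+1)
    (len : 'rV[R]_n.+1 -> 'rV[R]_n.+1 -> R) x y :
  x <> y -> ray x y `&` bd !=set0 ->
  (ray x y `&` bd) (exit_point ray bd x y) /\
  funk ray bd len x y =
    ln (len x (exit_point ray bd x y) / len y (exit_point ray bd x y)).
Proof.
by move=> xy b0; split; [exact: xgetPex|rewrite /funk asboolT].
Qed.

Lemma hilbertxx ray (bd : set 'rV[R]_n.+1)
    (len : 'rV[R]_n.+1 -> 'rV[R]_n.+1 -> R) x :
  hilbert ray bd len x x = 0.
Proof. by rewrite /hilbert /funk asboolF ?addr0 ?mul0r// => -[]. Qed.

(** Writing the hyperbolic exit point as [b = a *: x + c *: y], the hyperbolic
    ratio is [c / a] in absolute value, while the Euclidean one, measured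
    along the projected line, is the absolute value of
    [c * height y / (a * height x)]. *)
Lemma funk_vproj Om x y : Om `<=` hyperboloid ->
  open (Om : set (subspace hyperboloid)) -> hconvex Om ->
  Om x -> Om y -> x <> y ->
  hray x y `&` frontier_in hyperboloid Om !=set0 ->
  funk eray (frontier_in hyperplane (vproj @` Om)) edist (vproj x) (vproj y) =
  funk hray (frontier_in hyperboloid Om) (fun x y => sinh (hdist x y)) x y
    + (ln (height y) - ln (height x)).
Proof.
move=> OmH oOm cOm Ox Oy xy ne.
have [Hx Hy] := (OmH _ Ox, OmH _ Oy); have [[xx hx] [yy hy]] := (Hx, Hy).
have [bP ->] := funkE hray _ (fun x y => sinh (hdist x y)) x y xy ne.
set b := exit_point _ _ _ _ in bP *; case: bP => xyb bdb.
have [Hb [a [c [c0 bE]]]] := hray_comb x y b Hx xy xyb.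
have nOb : ~ Om b by move: bdb; rewrite frontier_in_openE// => -[].
have [bb hb] := Hb.
have [hx0 hy0 hb0] : [/\ height x != 0, height y != 0 & height b != 0].
  by rewrite !gt_eqF.
have bE' : b = c *: y + a *: x by rewrite addrC.
have Pb := vproj_comb x y b a c hx0 hy0 hb0 bE.
have Pb' := vproj_comb y x b c a hy0 hx0 hb0 bE'.
have onray : (eray (vproj x) (vproj y) `&`
    frontier_in hyperplane (vproj @` Om)) (vproj b).
  split; last exact: frontier_in_vproj.
  exists (c * height y / height b) => //=.
  rewrite in_itv/= andbT; exact: divr_ge0 (mulr_ge0 c0 (ltW hy)) (ltW hb).
have Pxy : vproj x <> vproj y by move/vproj_inj => /(_ Hx Hy).
have [eP ->] := funkE eray _ edist _ _ Pxy (ex_intro _ _ onray).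
have -> : exit_point eray (frontier_in hyperplane (vproj @` Om))
    (vproj x) (vproj y) = vproj b.
  apply: eray_frontier_unique eP onray.
  - exact: vproj_image_sub.
  - exact: vproj_image_open.
  - exact: vproj_image_convex.
  - by exists x.
(* If a coefficient of [b] vanished, then [b] would be [x] or [y], which lie in
   [Om]. *)
have a0 : a != 0.
  apply/eqP => a0; apply: nOb; rewrite (_ : b = y)//.
  by apply: vproj_inj => //; rewrite Pb' a0 !mul0r scale0r addr0.
have c1 : c != 0.
  apply/eqP => c1; apply: nOb; rewrite (_ : b = x)//.
  by apply: vproj_inj => //; rewrite Pb c1 !mul0r scale0r addr0.
have cp : 0 < c by rewrite lt0r c1.
rewrite (sinh_hdist_comb x y b a c)// (sinh_hdist_comb y x b c a)//.
rewrite (edist_scale _ (vproj b) (vproj x) (vproj y) (c * height y / height b));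
  last by rewrite Pb opprD addNKr -scalerN opprB.
rewrite (edist_scale _ (vproj b) (vproj y) (vproj x) (a * height x / height b));
  last by rewrite Pb' opprD addNKr -scalerN opprB.
rewrite (edistC (vproj y)) (hdistC y) !normrM !normfV.
rewrite (gtr0_norm hx) (gtr0_norm hy) (gtr0_norm hb) (gtr0_norm cp).
have E0 := edist_gt0 _ _ Pxy.
have S0 := sinh_gt0 _ (hdist_gt0 _ _ Hx Hy xy).
have an0 : 0 < `|a| by rewrite normr_gt0.
rewrite -ln_div// -lnM ?posrE; [|exact: divr_gt0 (mulr_gt0 _ _) (mulr_gt0 _ _)
  |exact: divr_gt0].
congr ln; move: (sinh _) (edist _ _) E0 S0 => S E E0 S0.
by field; rewrite hx0 hb0 !gt_eqF.
Qed.

(** The terms [ln (height y) - ln (height x)] by which the two Funk metrics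
    differ are antisymmetric. *)
Lemma hilbert_vproj Om x y : Om `<=` hyperboloid ->
  open (Om : set (subspace hyperboloid)) -> hconvex Om ->
  Om x -> Om y ->
  (x <> y -> hray x y `&` frontier_in hyperboloid Om !=set0) ->
  (x <> y -> hray y x `&` frontier_in hyperboloid Om !=set0) ->
  ehilbert (vproj @` Om) (vproj x) (vproj y) = hhilbert Om x y.
Proof.
move=> OmH oOm cOm Ox Oy xyb yxb; rewrite /ehilbert /hhilbert.
have [<-|xy] := pselect (x = y); first by rewrite !hilbertxx.
have yx := nesym xy; have [xb yb] := (xyb xy, yxb xy).
rewrite /hilbert (funk_vproj Om x y)// (funk_vproj Om y x)//.
have cancel p q : (p - q) + (q - p) = 0 :> R by ring.
by rewrite addrACA cancel addr0.
Qed.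

End HyperboloidModel.

Theorem corollary4p10 (R : realType) (n : nat) (Om : set 'rV[R]_n.+1)
    (Om_sub : Om `<=` hyperboloid)
    (Om_open : open (Om : set (subspace (@hyperboloid R n))))
    (Om_convex : hconvex Om) :
  [/\ vproj @` Om `<=` hyperplane,
      open (vproj @` Om : set (subspace (@hyperplane R n))) &
      convex_set (vproj @` Om : set (convex_lmodType 'rV[R]_n.+1))] /\
  [/\ set_bij Om (vproj @` Om) vproj,
      (forall x y, Om x -> Om y ->
         hray x y `&` frontier_in hyperboloid Om !=set0 ->
         hray y x `&` frontier_in hyperboloid Om !=set0 ->
         ehilbert (vproj @` Om) (vproj x) (vproj y) = hhilbert Om x y) &
      (forall x y, Om x -> Om y -> x <> y ->
         hray x y `&` frontier_in hyperboloid Om !=set0) ->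
      is_isometry Om (hhilbert Om)
        (vproj @` Om) (ehilbert (vproj @` Om)) vproj].
Proof.
have bij : set_bij Om (vproj @` Om) vproj.
  split; [by move=> x Ox; exists x|move=> x y /set_mem Ox /set_mem Oy|by []].
  by apply: vproj_inj; exact: Om_sub.
split.
  split; [exact: vproj_image_sub|exact: vproj_image_open|].
  exact: vproj_image_convex.
split=> // [x y Ox Oy xb yb|allb]; first exact: hilbert_vproj.
split=> // x y Ox Oy; apply: hilbert_vproj => // xy; apply: allb => //.
exact: nesym.
Qed.
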